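(* Let $r$ be a positive integer and $0 \le a \le 1$. Define $h : \binom{[3]}{2} \to [0,1]$ by $h(12) = h(13) = a$ and $h(23) = 0$, and let $\mathcal{F} = \{(3,h), K_{r+1}^0\}$. Then $$d(\mathcal{F}) = \begin{cases} \frac12, & \text{if } a \le \frac12,\\ a + \frac{1-2a}{r}, & \text{if } a > \frac12 \text{ and } r \text{ is even},\\ \frac{a^2(r-1)}{a(r+1)-1}, & \text{if } a > \frac12 \text{ and } r \text{ is odd}.\end{cases}$$
   Context: An edge weighting of a graph $G$ is a map $w : E(G) \to [0,1]$; for an $n$-vertex graph, $w(G) := \frac{2}{n^2}\sum_{e\in E(G)} w(e)$. A weighted clique is a pair $(r,f)$ with $f : \binom{[r]}{2} \to [0,1]$; $(G,w)$ contains $(r,f)$ if there is an injective $\phi:[r]\to V(G)$ with $\phi(i)\phi(j) \in E(G)$ and $w(\phi(i)\phi(j)) > f(ij)$ for all $i<j$. For $a \in [0,1]$, $K_r^a$ is the weighted clique $(r,f)$ with $f \equiv a$. For a set $\mathcal{F}$ of weighted cliques, $(G,w)$ is $\mathcal{F}$-free if it contains none of them; $\beta_n(\mathcal{F})$ is the maximum of $w(G)$ over $\mathcal{F}$-free weighted graphs on $n$ vertices, and $d(\mathcal{F}) := \lim_{n\to\infty}\beta_n(\mathcal{F})$.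
   Formalization: The case r = 1 with a ≤ 1/2 is excluded: there K_2^0 is forbidden, so all edges have weight 0 and d(F) = 0, not 1/2 as printed; all other cases are as stated. *)

(* Defs.v *)
From HB Require Import structures.
From mathcomp Require Import all_boot all_order all_algebra.
From mathcomp Require Import boolp classical_sets reals topology normedtype.
From mathcomp Require Import sequences.

Set Implicit Arguments.
Unset Strict Implicit.
Unset Printing Implicit Defensive.

Import Order.TTheory GRing.Theory Num.Theory.
Import numFieldNormedType.Exports.

Local Open Scope ring_scope.

Record sgraph (V : finType) := SGraph {
  edges : {set {set V}};
  edges_card2 : forall e, e \in edges -> #|e| = 2%N }.

(* Only the values of [w] on [edges G] are meaningful. *)
Definition edge_weighting (R : realType) (V : finType) (G : sgraph V)
    (w : {set V} -> R) : Prop :=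
  forall e, e \in edges G -> 0 <= w e <= 1.

Definition total_weight (R : realType) (V : finType) (G : sgraph V)
    (w : {set V} -> R) : R :=
  2 / #|V|%:R ^+ 2 * \sum_(e in edges G) w e.

(* The vertex set {1, .., r} is 'I_r, shifted by one; [wc_fun] only matters on 2-sets. *)
Record wclique (R : realType) := WClique {
  wc_size : nat;
  wc_fun : {set 'I_wc_size} -> R;
  wc_fun01 : forall e : {set 'I_wc_size}, #|e| = 2%N -> 0 <= wc_fun e <= 1 }.

Definition wcontains (R : realType) (V : finType) (G : sgraph V)
    (w : {set V} -> R) (C : wclique R) : Prop :=
  exists phi : 'I_(wc_size C) -> V,
    injective phi /\
    forall i j : 'I_(wc_size C), (i < j)%N ->
      [set phi i; phi j]%SET \in edges G /\
      wc_fun [set i; j]%SET < w [set phi i; phi j]%SET.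

Definition wfree (R : realType) (V : finType) (F : set (wclique R))
    (G : sgraph V) (w : {set V} -> R) : Prop :=
  forall C, F C -> ~ wcontains G w C.

Definition free_weights (R : realType) (F : set (wclique R)) (n : nat) : set R :=
  [set x | exists (G : sgraph 'I_n) (w : {set 'I_n} -> R),
     [/\ edge_weighting G w, wfree F G w & x = total_weight G w]]%classic.

(* "beta_n(F) = b": the maximum is required to be attained. *)
Definition is_beta (R : realType) (F : set (wclique R)) (n : nat) (b : R) : Prop :=
  free_weights F n b /\ ubound (free_weights F n) b.

(* "d(F) = l": every beta_n(F) exists and the limit exists and equals l. *)
Definition is_density (R : realType) (F : set (wclique R)) (l : R) : Prop :=
  exists beta : nat -> R,
    (forall n, is_beta F n (beta n)) /\ (beta n @[n --> \oo] --> l)%classic.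

Definition Kclique (R : realType) (r : nat) (a : R) (ha : 0 <= a <= 1) :
    wclique R :=
  @WClique R r (fun=> a) (fun _ _ => ha).

Lemma zero01 (R : realType) : 0 <= (0 : R) <= 1.
Proof. by rewrite lexx ler01. Qed.

(* 'I_3 = {0, 1, 2} stands for {1, 2, 3}, so {1, 2} is the pair 23. *)
Definition h_fun (R : realType) (a : R) (e : {set 'I_3}) : R :=
  if e == [set inord 1; inord 2]%SET then 0 else a.

Lemma h_fun01 (R : realType) (a : R) (ha : 0 <= a <= 1) (e : {set 'I_3}) :
  #|e| = 2%N -> 0 <= h_fun a e <= 1.
Proof. by move=> _; rewrite /h_fun; case: ifP => // _; apply: zero01. Qed.

Definition h_clique (R : realType) (a : R) (ha : 0 <= a <= 1) : wclique R :=
  @WClique R 3 (h_fun a) (h_fun01 ha).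

Definition forbidden (R : realType) (r : nat) (a : R) (ha : 0 <= a <= 1) :
    set (wclique R) :=
  [set h_clique ha; Kclique r.+1 (zero01 R)]%classic.

(* Main.v *)
Require Import Defs.
From HB Require Import structures.
From mathcomp Require Import all_boot all_order all_algebra.
From mathcomp Require Import boolp classical_sets reals topology normedtype.
From mathcomp Require Import sequences.
From mathcomp Require Import ring lra zify.
(* Reimported: [cover], [trivIset], [setUC] would otherwise be those of classical_sets. *)
From mathcomp Require Import fintype finset.

Set Implicit Arguments.
Unset Strict Implicit.
Unset Printing Implicit Defensive.

Import Order.TTheory GRing.Theory Num.Theory.
Import numFieldNormedType.Exports.

Local Open Scope set_scope.
Local Open Scope ring_scope.

(** Upper bound: the weight of a graph is the value at the uniform distribution
    of a quadratic form on the simplex of vertex distributions.  Zykov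
    symmetrization moves all mass onto a clique, of size at most [r], whose edges
    heavier than [a] form a matching.  There the form is at most
    [a - \sum_u d_u x_u^2] with [d_u = 2a - 1] on matched vertices and [d_u = a]
    on the others, and Cauchy-Schwarz gives [a - 1 / \sum_u d_u^-1]; the sum is
    largest when as many of the [r] vertices as parity allows are matched.  If
    [a <= 1/2], the same argument with [a] replaced by [1/2] gives [1/2].

    Lower bound: blow up the extremal clique, adding vertices one at a time to a
    class of largest current weight.  At the optimal distribution every class
    sees the same weight [d], so [n] vertices carry at least [d (1 - 1/n)]. *)

Lemma sum_set2 (M : nmodType) (V : finType) (F : {set V} -> M) :
  \sum_u \sum_(v | u != v) F [set u; v] =
  (\sum_(e : {set V} | #|e| == 2%N) F e) *+ 2.
Proof.
rewrite pair_big_dep /=.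
rewrite (partition_big (fun p : V * V => [set p.1; p.2])
  (fun e : {set V} => #|e| == 2%N)) /=; last by move=> p; rewrite cards2 => ->.
rewrite -sumrMnl; apply: eq_bigr => e /cards2P [p [q [pq ->]]].
rewrite (bigD1 (p, q)) /= ?pq ?eqxx // (bigD1 (q, p)) /=; last first.
  by rewrite eq_sym pq setUC eqxx /= xpair_eqE eq_sym (negbTE pq).
rewrite big1 ?addr0 => [|[u v] /=]; first by rewrite setUC mulr2n.
case/andP => /andP [/andP [uv /eqP uv_pq] uvNpq] uvNqp.
have up : u \in [set p; q] by rewrite -uv_pq !inE eqxx.
have vp : v \in [set p; q] by rewrite -uv_pq !inE eqxx orbT.
move: up vp uvNpq uvNqp uv; rewrite !inE !xpair_eqE.
by case/orP => /eqP -> /orP [] /eqP ->; rewrite !eqxx ?andbF.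
Qed.

Definition hollow_symmetric {T : Type} {R : nmodType} (W : T -> T -> R) : Prop :=
  (forall u v, W u v = W v u) /\ (forall u, W u u = 0).

Section QuadraticForm.
Context {R : comPzRingType} {V : finType}.
Implicit Types (W : V -> V -> R) (x F : V -> R).

Definition wdeg W x (u : V) : R := \sum_v x v * W u v.

Definition qform W x : R := \sum_u x u * wdeg W x u.

Definition transfer x (c : R) (u v : V) : V -> R :=
  fun t => x t + c * ((t == u)%:R - (t == v)%:R).

Lemma sum_mul_delta F u : \sum_t F t * (t == u)%:R = F u.
Proof.
under eq_bigr => t _ do rewrite mulr_natr mulrb.
by rewrite -big_mkcond big_pred1_eq.
Qed.

Lemma sum_transfer_mul x c u v F :
  \sum_t transfer x c u v t * F t = \sum_t x t * F t + c * (F u - F v).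
Proof.
rewrite -(sum_mul_delta F u) -(sum_mul_delta F v) -sumrB mulr_sumr -big_split /=.
by apply: eq_bigr => t _; rewrite /transfer; ring.
Qed.

Lemma sum_transfer x c u v : \sum_t transfer x c u v t = \sum_t x t.
Proof.
have := sum_transfer_mul x c u v (fun=> 1); rewrite subrr mulr0 addr0.
by under eq_bigr do rewrite mulr1; under [in RHS]eq_bigr do rewrite mulr1.
Qed.

Lemma qform_transfer W x c u v : hollow_symmetric W -> W u v = 0 ->
  qform W (transfer x c u v) = qform W x + 2 * c * (wdeg W x u - wdeg W x v).
Proof.
move=> [Wsym Wdiag] Wuv; rewrite /qform {2}/wdeg.
under eq_bigr => s _ do rewrite /wdeg sum_transfer_mul.
rewrite sum_transfer_mul !Wdiag (Wsym v u) Wuv /wdeg.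
under [X in X + _]eq_bigr => s _ do
  rewrite mulrDr mulrCA mulrBr (Wsym s u) (Wsym s v).
by rewrite big_split /= -mulr_sumr sumrB; ring.
Qed.

Lemma qform_delta x : qform (fun u v => (v == u)%:R) x = \sum_u x u ^+ 2.
Proof. by apply: eq_bigr => u _; rewrite /wdeg sum_mul_delta expr2. Qed.

Lemma qform_const1 x : qform (fun _ _ => 1) x = (\sum_u x u) ^+ 2.
Proof.
rewrite expr2 mulr_suml; apply: eq_bigr => u _.
by congr (_ * _); apply: eq_bigr => v _; rewrite mulr1.
Qed.

Lemma qformD W1 W2 x :
  qform (fun u v => W1 u v + W2 u v) x = qform W1 x + qform W2 x.
Proof.
rewrite /qform -big_split /=; apply: eq_bigr => u _.
rewrite /wdeg -mulrDr -big_split /=; congr (_ * _).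
by apply: eq_bigr => v _; rewrite mulrDr.
Qed.

Lemma qformZ (c : R) W x : qform (fun u v => c * W u v) x = c * qform W x.
Proof.
rewrite /qform mulr_sumr; apply: eq_bigr => u _.
rewrite mulrCA; congr (_ * _); rewrite /wdeg mulr_sumr.
by apply: eq_bigr => v _; rewrite mulrCA.
Qed.

End QuadraticForm.

Section QuadraticFormBounds.
Context {R : realDomainType} {V : finType}.
Implicit Types (W : V -> V -> R) (x : V -> R) (M : {set {set V}}).

Lemma ler_qform W1 W2 x : (forall u, 0 <= x u) ->
  {in support x &, forall u v, W1 u v <= W2 u v} -> qform W1 x <= qform W2 x.
Proof.
move=> x_ge0 W12; apply: ler_sum => u _.
have [->|xu] := eqVneq (x u) 0; first by rewrite !mul0r.
apply: ler_wpM2l => //; apply: ler_sum => v _.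
have [->|xv] := eqVneq (x v) 0; first by rewrite !mul0r.
by apply: ler_wpM2l => //; apply: W12.
Qed.

(* Between two non-adjacent vertices the form is affine along mass transfer, so one
   of the two can be emptied without decreasing it. *)
Lemma symmetrization_step W x u v : hollow_symmetric W -> (forall t, 0 <= x t) ->
    u \in support x -> v \in support x -> u != v -> W u v = 0 ->
  exists y, [/\ forall t, 0 <= y t, \sum_t y t = \sum_t x t,
    qform W x <= qform W y & [pred t in support y] \proper support x].
Proof.
move=> Whs x_ge0.
wlog deg_le : u v / wdeg W x v <= wdeg W x u => [wlog_deg xu xv uv Wuv|].
  have [deg_le|/ltW deg_le] := leP (wdeg W x v) (wdeg W x u).
    exact: wlog_deg deg_le xu xv uv Wuv.
  by apply: (wlog_deg v u deg_le xv xu); [rewrite eq_sym|rewrite Whs.1].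
move=> xu xv uv Wuv.
have yv : transfer x (x v) u v v = 0.
  by rewrite /transfer eqxx eq_sym (negbTE uv) sub0r mulrN1 subrr.
have yE t : t != v -> transfer x (x v) u v t = x t + x v * (t == u)%:R.
  by move=> tv; rewrite /transfer (negbTE tv) subr0.
exists (transfer x (x v) u v); split.
- move=> t; have [->|tv] := eqVneq t v; first by rewrite yv.
  by rewrite yE // addr_ge0 ?mulr_ge0.
- exact: sum_transfer.
- by rewrite qform_transfer // lerDl !mulr_ge0 ?subr_ge0.
apply/properP; split; last by exists v; rewrite // !inE yv eqxx.
apply/subsetP => t; rewrite !inE; apply: contraNN => /eqP xt.
have [->|tv] := eqVneq t v; first by rewrite yv.
have /negbTE tu : t != u by apply: contraNneq xu => <-; rewrite xt.
by rewrite yE // xt tu mulr0 addr0.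
Qed.

Lemma qform_le_cliques W (l : R) : hollow_symmetric W ->
  (forall x, (forall u, 0 <= x u) ->
    {in support x &, forall u v, u != v -> W u v != 0} ->
    qform W x <= l * (\sum_u x u) ^+ 2) ->
  forall x, (forall u, 0 <= x u) -> qform W x <= l * (\sum_u x u) ^+ 2.
Proof.
move=> Whs clique_bound x.
have [k] := ubnP #|support x|; elim: k x => // k IH x supp_lt x_ge0.
have [|clique] := boolP [exists u in support x, exists v in support x,
    (u != v) && (W u v == 0)]; last first.
  apply: clique_bound => // u v xu xv uv; apply: contra clique => Wuv.
  by apply/exists_inP; exists u => //; apply/exists_inP; exists v; rewrite ?uv.
move=> /exists_inP [u xu /exists_inP [v xv /andP [uv /eqP Wuv]]].
have [y [y_ge0 <- le_qform /proper_card supp_y]] :=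
  symmetrization_step Whs x_ge0 xu xv uv Wuv.
apply: le_trans le_qform (IH y _ y_ge0).
exact: leq_trans supp_y supp_lt.
Qed.

Definition matching M : Prop := trivIset M /\ {in M, forall e : {set V}, #|e| = 2%N}.

Lemma card_cover_matching M : matching M -> #|cover M| = #|M|.*2.
Proof.
move=> [/eqP <- M2]; rewrite (eq_bigr (fun=> 2%N)) //.
by rewrite sum_nat_const muln2.
Qed.

Lemma qform_matching_le M x : matching M ->
  qform (fun u v => ([set u; v] \in M)%:R) x <= \sum_(u in cover M) x u ^+ 2.
Proof.
move=> [tiM M2]; pose xprod (e : {set V}) : R := (\prod_(u in e) x u) *+ (e \in M).
have -> : qform (fun u v => ([set u; v] \in M)%:R) x =
    \sum_u \sum_(v | u != v) xprod [set u; v].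
  apply: eq_bigr => u _; rewrite mulr_sumr [RHS]big_mkcond.
  apply: eq_bigr => v _; rewrite /xprod; case: eqVneq => [<-|uv] /=.
    have [/M2|_] := boolP ([set u; u] \in M); first by rewrite setUid cards1.
    by rewrite !mulr0.
  by rewrite big_setU1 ?inE //= big_set1 mulr_natr mulrnAr.
rewrite sum_set2 -sumrMnl big_trivIset //= big_mkcond [leRHS]big_mkcond.
apply: ler_sum => e _; rewrite /xprod.
have [eM|] := boolP (e \in M); last by rewrite mul0rn; case: ifP.
have /eqP/cards2P [u [v [uv ->]]] := M2 e eM.
rewrite cards2 uv !big_setU1 ?inE //= !big_set1 mulr1n.
by rewrite -subr_ge0 (_ : _ - _ = (x u - x v) ^+ 2) ?sqr_ge0 //; ring.
Qed.

End QuadraticFormBounds.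

Lemma sqr_sum_div_le {R : realFieldType} (I : finType) (P : pred I)
    (d x : I -> R) (T : R) :
    (forall i, P i -> 0 < d i) -> 0 < T -> \sum_(i | P i) (d i)^-1 <= T ->
  (\sum_(i | P i) x i) ^+ 2 / T <= \sum_(i | P i) d i * x i ^+ 2.
Proof.
set s := \sum_(i | P i) x i => d_gt0 T_gt0 dT; pose slope := s / T.
(* Cauchy-Schwarz: [d i * x i ^+ 2] lies above its tangent of slope [2 * slope]. *)
have tangent i : P i -> 2 * slope * x i - slope ^+ 2 * (d i)^-1 <= d i * x i ^+ 2.
  move=> /d_gt0 di_gt0; rewrite -subr_ge0.
  rewrite (_ : _ - _ = (d i * x i - slope) ^+ 2 / d i); last by field; rewrite gt_eqF.
  by rewrite divr_ge0 ?sqr_ge0 ?ltW.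
apply: le_trans (ler_sum _ tangent); rewrite sumrB -!mulr_sumr -/s.
have -> : s ^+ 2 / T = 2 * slope * s - slope ^+ 2 * T.
  by rewrite /slope; field; rewrite gt_eqF.
by rewrite lerD2l lerN2 ler_wpM2l ?sqr_ge0.
Qed.

Section CliqueDensity.
Context {R : realFieldType}.
Implicit Types (a : R) (r : nat).

Definition defect a (matched : bool) : R := if matched then 2 * a - 1 else a.
Arguments defect : simpl never.

(* At most [r./2.*2] of [r] vertices can be matched. *)
Definition inv_defect_sum r a : R :=
  (r./2.*2)%:R / defect a true + (odd r)%:R / defect a false.

Definition density_value r a : R :=
  if a <= 1 / 2 then 1 / 2 else a - (inv_defect_sum r a)^-1.

Lemma density_valueE r a : (0 < r)%N ->
  density_value r a =
    (if a <= 1 / 2 then 1 / 2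
     else if ~~ odd r then a + (1 - 2 * a) / r%:R
     else a ^+ 2 * (r%:R - 1) / (a * (r%:R + 1) - 1)).
Proof.
move=> r_gt0; rewrite /density_value; case: ifPn => //; rewrite -ltNge => a_gt.
have r_eq : r%:R = (odd r)%:R + (r./2.*2)%:R :> R by rewrite -natrD odd_double_half.
have : 0 < r%:R :> R by rewrite ltr0n.
have : 0 <= (r./2.*2)%:R :> R by [].
rewrite /inv_defect_sum /defect r_eq; move: (r./2.*2)%:R => m m_ge0.
have matched_gt0 : 0 < 2 * a - 1 by lra.
have a_gt0 : 0 < a by lra.
case: (odd r) => /= m_gt0.
  have denom_gt0 : 0 < a * (1 + m + 1) - 1.
    rewrite (_ : _ - 1 = m * a + (2 * a - 1)); last by ring.
    by rewrite ltr_wpDl // mulr_ge0 // ltW.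
  by field; rewrite !gt_eqF.
by field; rewrite !gt_eqF // -[m]add0r.
Qed.

Lemma defect_gt0 a matched : 1 / 2 < a -> 0 < defect a matched.
Proof. by rewrite /defect; case: matched; lra. Qed.

Lemma inv_defect_sum_gt0 r a : (0 < r)%N -> 1 / 2 < a -> 0 < inv_defect_sum r a.
Proof.
move=> r_gt0 a_gt; have defect_inv_gt0 b : 0 < (defect a b)^-1.
  by rewrite invr_gt0 defect_gt0.
move: r_gt0; rewrite /inv_defect_sum -{1}(odd_double_half r).
case: (odd r) => /= r_gt0.
  by rewrite ltr_wpDl ?mulr_gt0 // mulr_ge0 // ltW.
by rewrite mul0r addr0 mulr_gt0 // ltr0n.
Qed.

Lemma sum_inv_defect (V : finType) (D S : {set V}) a : D \subset S ->
  \sum_(u in S) (defect a (u \in D))^-1 =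
  #|D|%:R / defect a true + (#|S| - #|D|)%:R / defect a false.
Proof.
move=> /setIidPr SD; rewrite (big_setID D) /= SD.
rewrite (eq_bigr (fun=> (defect a true)^-1)) => [|u -> //].
rewrite [X in _ + X](eq_bigr (fun=> (defect a false)^-1)) => [|u]; last first.
  by rewrite inE => /andP [/negbTE ->].
by rewrite !sumr_const cardsD SD !mulr_natl.
Qed.

Lemma sum_inv_defect_le (V : finType) (D S : {set V}) r a : 1 / 2 < a <= 1 ->
    D \subset S -> ~~ odd #|D| -> (#|S| <= r)%N ->
  \sum_(u in S) (defect a (u \in D))^-1 <= inv_defect_sum r a.
Proof.
move=> /andP [a_gt a_le1] DS even_D Sr; rewrite (sum_inv_defect a DS).
have D_le_S := subset_leq_card DS.
have D_le : 0 <= (r./2.*2)%:R - #|D|%:R :> R.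
  by rewrite subr_ge0 ler_nat; move: even_D; lia.
have S_le : 0 <= (odd r)%:R + (r./2.*2)%:R - #|S|%:R :> R.
  by rewrite -natrD odd_double_half subr_ge0 ler_nat.
have inv_unmatched_ge0 : 0 <= (defect a false)^-1 by rewrite invr_ge0 ltW ?defect_gt0.
have inv_defect_le : 0 <= (defect a true)^-1 - (defect a false)^-1.
  by rewrite subr_ge0 lef_pV2 ?posrE ?defect_gt0 // /defect; lra.
have := mulr_ge0 D_le inv_defect_le; have := mulr_ge0 S_le inv_unmatched_ge0.
by rewrite natrB // /inv_defect_sum; lra.
Qed.

Definition matching_weight a (V : finType) (M : {set {set V}}) (u v : V) : R :=
  if [set u; v] \in M then 1 else a.

Lemma qform_le_matching (V : finType) (W : V -> V -> R) x (M : {set {set V}}) a :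
    a <= 1 -> matching M -> (forall u, 0 <= x u) -> (forall u, W u u = 0) ->
    {in support x &, forall u v, u != v -> W u v <= matching_weight a M u v} ->
  qform W x <=
    a * (\sum_u x u) ^+ 2 - \sum_u defect a (u \in cover M) * x u ^+ 2.
Proof.
move=> a_le1 matchM x_ge0 Wdiag W_le; have a1 : 0 <= 1 - a by rewrite subr_ge0.
have dominated : qform W x <= qform (fun u v =>
    a * 1 + - a * (v == u)%:R + (1 - a) * ([set u; v] \in M)%:R) x.
  apply: ler_qform => // u v xu xv; have [->|uv] := eqVneq v u.
    by rewrite Wdiag /= mulr1n !mulr1 addrN add0r mulr_ge0.
  apply: le_trans (W_le u v xu xv _) _; first by rewrite eq_sym.
  rewrite /matching_weight.
  by case: ifP => _; rewrite /= ?mulr0n ?mulr1n !(mulr0, mulr1, addr0) // addrC subrK.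
apply: le_trans dominated _; rewrite !qformD !qformZ qform_const1 qform_delta.
have := ler_wpM2l a1 (qform_matching_le x matchM).
suff -> : \sum_u defect a (u \in cover M) * x u ^+ 2 =
    a * (\sum_u x u ^+ 2) - (1 - a) * \sum_(u in cover M) x u ^+ 2 by lra.
rewrite [X in _ - _ * X]big_mkcond !mulr_sumr -sumrB; apply: eq_bigr => u _.
by rewrite /defect; case: ifP => _; ring.
Qed.

Lemma qform_le_density_value (V : finType) (W : V -> V -> R) x (M : {set {set V}}) r a :
    (0 < r)%N -> a <= 1 -> (forall u, 0 <= x u) -> (#|support x| <= r)%N ->
    matching M -> cover M \subset support x -> (forall u, W u u = 0) ->
    {in support x &, forall u v, u != v -> W u v <= matching_weight a M u v} ->
  qform W x <= density_value r a * (\sum_u x u) ^+ 2.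
Proof.
move=> r_gt0 a_le1 x_ge0 supp_r matchM coverM Wdiag W_le.
rewrite /density_value; case: ifPn => [a_le|]; last rewrite -ltNge => a_gt.
  have W_le_half : {in support x &, forall u v, u != v ->
      W u v <= matching_weight (1 / 2) M u v}.
    move=> u v xu xv uv; apply: le_trans (W_le u v xu xv uv) _.
    by rewrite /matching_weight; case: ifP.
  apply: le_trans (qform_le_matching _ matchM x_ge0 Wdiag W_le_half) _; first by lra.
  rewrite gerBl sumr_ge0 // => u _; rewrite mulr_ge0 ?sqr_ge0 // /defect.
  by case: ifP; lra.
apply: le_trans (qform_le_matching a_le1 matchM x_ge0 Wdiag W_le) _.
rewrite mulrBl lerD2l lerN2 mulrC.
have sum_support (F : V -> R) : (forall u, x u = 0 -> F u = 0) ->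
    \sum_u F u = \sum_(u in [set u in support x]) F u.
  by move=> F0; rewrite [RHS]big_rmcond // => u; rewrite !inE negbK => /eqP/F0.
rewrite !sum_support // => [|u ->]; last by rewrite expr0n mulr0.
apply: sqr_sum_div_le => [u _||]; [exact: defect_gt0|exact: inv_defect_sum_gt0|].
apply: sum_inv_defect_le; rewrite ?a_gt ?cardsE //.
- by apply/subsetP => u /(subsetP coverM); rewrite inE.
- by rewrite card_cover_matching // odd_double.
Qed.

End CliqueDensity.

Section Adjacency.
Context {R : realType} {V : finType}.
Implicit Types (G : sgraph V) (w : {set V} -> R) (C : wclique R).

Definition adj G w (u v : V) : R :=
  if [set u; v] \in edges G then w [set u; v] else 0.

Lemma edge_neq G u v : [set u; v] \in edges G -> u != v.
Proof. by move=> /edges_card2; rewrite cards2; case: (u != v). Qed.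

Lemma adj_hollow_symmetric G w : hollow_symmetric (adj G w).
Proof.
split=> [u v|u]; first by rewrite /adj setUC.
by rewrite /adj; case: ifP => // /edge_neq; rewrite eqxx.
Qed.

Lemma adj01 G w u v : edge_weighting G w -> 0 <= adj G w u v <= 1.
Proof. by move=> w01; rewrite /adj; case: ifP => [/w01 //|_]; rewrite lexx ler01. Qed.

Lemma total_weight_qform G w :
  total_weight G w = qform (adj G w) (fun=> 1) / #|V|%:R ^+ 2.
Proof.
rewrite /total_weight /qform [RHS]mulrC -mulrA mulrCA; congr (_ * _).
transitivity ((\sum_(e : {set V} | #|e| == 2%N)
    if e \in edges G then w e else 0) *+ 2).
  rewrite mulr_natl -big_mkcondr /=; congr (_ *+ 2); apply: eq_bigl => e.
  by apply/idP/andP => [eG|[]//]; rewrite (edges_card2 eG).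
rewrite -sum_set2; apply: eq_bigr => u _; rewrite mul1r [LHS]big_mkcond /=.
apply: eq_bigr => v _; rewrite mul1r; case: eqVneq => //= <-.
by rewrite (adj_hollow_symmetric G w).2.
Qed.

Lemma wc_fun_pair_ge0 C (i j : 'I_(wc_size C)) : (i < j)%N -> 0 <= wc_fun [set i; j].
Proof.
move=> ij; suff /wc_fun01 /andP [] : #|[set i; j]| = 2%N by [].
by rewrite cards2 neq_ltn ij.
Qed.

Lemma wcontainsP G w C :
  wcontains G w C <-> exists phi : 'I_(wc_size C) -> V,
    forall i j : 'I_(wc_size C), (i < j)%N ->
      wc_fun [set i; j] < adj G w (phi i) (phi j).
Proof.
split=> [[phi [_ contained]]|[phi contained]]; exists phi.
  by move=> i j /contained [edge_ij]; rewrite /adj edge_ij.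
have phi_neq (i j : 'I_(wc_size C)) : (i < j)%N -> phi i != phi j.
  move=> ij; have := le_lt_trans (wc_fun_pair_ge0 ij) (contained i j ij).
  by apply: contraTneq => ->; rewrite (adj_hollow_symmetric G w).2 ltxx.
split=> [i j phi_ij|i j ij].
  by apply/val_inj; case: (ltngtP i j) => // /phi_neq; rewrite phi_ij eqxx.
have := contained i j ij; rewrite /adj; case: ifP => // _.
by rewrite ltNge wc_fun_pair_ge0.
Qed.

Lemma wcontains_size_le G w C : wcontains G w C -> (wc_size C <= #|V|)%N.
Proof. by move=> [phi [/leq_card]]; rewrite card_ord. Qed.

Lemma wcontains_Kclique G w k (a : R) (ha : 0 <= a <= 1) (S : {set V}) :
  (k <= #|S|)%N -> {in S &, forall u v, u != v -> a < adj G w u v} ->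
  wcontains G w (Kclique k ha).
Proof.
move=> kS clique; apply/wcontainsP => /=.
exists (fun i : 'I_k => enum_val (widen_ord kS i)) => i j ij.
apply: clique; rewrite ?enum_valP // (inj_eq enum_val_inj).
by rewrite -val_eqE /= neq_ltn ij.
Qed.

Lemma h_funE (a : R) (i j : 'I_3) : (i < j)%N ->
  h_fun a [set i; j] = if i == 0%N :> nat then a else 0.
Proof.
rewrite /h_fun => ij; have [i0|i_gt0] := eqVneq (i : nat) 0%N.
  case: eqP => // /setP /(_ i); rewrite !inE eqxx.
  by rewrite -!val_eqE /= !inordK // i0.
rewrite (_ : i = inord 1) 1?(_ : j = inord 2) ?eqxx //; apply/val_inj;
  rewrite /= inordK //; have := ltn_ord j; lia.
Qed.

Lemma wcontains_hP G w (a : R) (ha : 0 <= a <= 1) :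
  wcontains G w (h_clique ha) <->
  exists u v t, [/\ a < adj G w u v, a < adj G w u t & 0 < adj G w v t].
Proof.
split=> [/wcontainsP [/= phi contained]|[u [v [t [uv ut vt]]]]].
  have contained_h (i j : 'I_3) : (i < j)%N ->
      (if i == 0%N :> nat then a else 0) < adj G w (phi i) (phi j).
    by move=> ij; rewrite -(h_funE a ij) contained.
  pose vertex1 := @Ordinal 3 1 isT.
  exists (phi ord0), (phi vertex1), (phi ord_max); split.
  - exact: (contained_h ord0 vertex1 isT).
  - exact: (contained_h ord0 ord_max isT).
  - exact: (contained_h vertex1 ord_max isT).
apply/wcontainsP; exists (tnth [tuple u; v; t]) => i j ij /=.
rewrite h_funE // !(tnth_nth u) /=.
by case: i j ij => [[|[|[|i]]] Hi] [[|[|[|j]]] Hj].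
Qed.

Lemma wfree_zero (F : set (wclique R)) G :
  (forall C, F C -> (1 < wc_size C)%N) -> wfree F G (fun=> 0).
Proof.
move=> F_size C FC [phi [_ contained]]; have size_gt1 := F_size C FC.
have [|_] := contained (Ordinal (ltnW size_gt1)) (Ordinal size_gt1); first by [].
by rewrite ltNge wc_fun_pair_ge0.
Qed.

End Adjacency.

Section UpperBound.
Context {R : realType} {V : finType}.
Variables (G : sgraph V) (w : {set V} -> R).

Definition heavy_edges (a : R) (S : {set V}) : {set {set V}} :=
  [set e in edges G | (e \subset S) && (a < w e)].

Lemma heavy_edge_neighbor a S e u : 0 <= a -> e \in heavy_edges a S -> u \in e ->
  exists v, [/\ v \in S, a < adj G w u v & e = [set u; v]].
Proof.
move=> a_ge0; rewrite inE => /and3P [eG eS ae] ue.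
have /eqP := edges_card2 eG; rewrite (cardsD1 u) ue eqSS => /cards1P [v e_minus].
have e_eq : e = [set u; v] by rewrite -e_minus setD1K.
exists v; split=> //; last by rewrite /adj -e_eq eG.
by apply: (subsetP eS); rewrite e_eq !inE eqxx orbT.
Qed.

Lemma matching_heavy_edges a (ha : 0 <= a <= 1) (S : {set V}) :
    ~ wcontains G w (h_clique ha) ->
    {in S &, forall u v, u != v -> 0 < adj G w u v} ->
  matching (heavy_edges a S).
Proof.
move=> h_free clique; have /andP [a_ge0 _] := ha.
split=> [|e]; last by rewrite inE => /andP [/edges_card2].
apply/trivIsetP => e f eM fM; apply: contraR => /pred0Pn [u /andP [/= ue uf]].
have [v [vS uv ->]] := heavy_edge_neighbor a_ge0 eM ue.
have [t [tS ut ->]] := heavy_edge_neighbor a_ge0 fM uf.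
apply/eqP; congr [set u; _]; apply/eqP/negPn/negP => vt.
by apply: h_free; apply/wcontains_hP; exists u, v, t; split=> //; apply: clique.
Qed.

Hypothesis w01 : edge_weighting G w.

Lemma adj_le_heavy (a : R) (S : {set V}) : 0 <= a ->
  {in S &, forall u v, adj G w u v <= matching_weight a (heavy_edges a S) u v}.
Proof.
move=> a_ge0 u v uS vS; have /andP [_ adj_le1] := adj01 u v w01.
rewrite /matching_weight; case: ifPn => //; rewrite inE subUset !sub1set uS vS /= /adj.
by case: ifP => //= _; rewrite -leNgt.
Qed.

Lemma total_weight_le (r : nat) a (ha : 0 <= a <= 1) : (0 < r)%N -> (0 < #|V|)%N ->
  wfree (forbidden r ha) G w -> total_weight G w <= density_value r a.
Proof.
move=> r_gt0 V_gt0 w_free; have /andP [a_ge0 a_le1] := ha.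
have hs := adj_hollow_symmetric G w.
rewrite total_weight_qform ler_pdivrMr ?exprn_gt0 ?ltr0n //.
have -> : #|V|%:R = \sum_(u : V) 1 :> R by rewrite sumr_const cardT -cardE.
apply: qform_le_cliques => // x x_ge0 x_clique; pose S := [set u in support x].
have clique : {in S &, forall u v, u != v -> 0 < adj G w u v}.
  move=> u v; rewrite !inE => xu xv uv; have /andP [adj_ge0 _] := adj01 u v w01.
  by rewrite lt_def adj_ge0 x_clique.
apply: (@qform_le_density_value _ _ _ _ (heavy_edges a S)) => //.
- rewrite -cardsE leqNgt; apply/negP => rS.
  by apply: (w_free (Kclique r.+1 (zero01 R))); [right|apply: wcontains_Kclique clique].
- by apply: matching_heavy_edges clique; apply: w_free; left.
- apply/bigcupsP => e; rewrite inE => /and3P [_ eS _].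
  by apply/subsetP => u /(subsetP eS); rewrite inE.
- exact: hs.2.
by move=> u v xu xv _; apply: adj_le_heavy; rewrite ?inE.
Qed.

End UpperBound.

Lemma complete_edges_card2 (V : finType) (e : {set V}) :
  e \in [set e : {set V} | #|e| == 2%N] -> #|e| = 2%N.
Proof. by rewrite inE => /eqP. Qed.

Definition complete_sgraph (V : finType) : sgraph V :=
  SGraph (@complete_edges_card2 V).

(* [W] as a function of 2-sets: the double sum sees each pair in both orders. *)
Definition matrix_weight {R : realType} {V : finType} (W : V -> V -> R)
    (e : {set V}) : R :=
  (\sum_(u in e) \sum_(v in e) W u v) / 2.

Lemma hollow_symmetric_comp (S T : Type) (R : nmodType) (W : T -> T -> R) (f : S -> T) :
  hollow_symmetric W -> hollow_symmetric (fun u v => W (f u) (f v)).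
Proof. by move=> [Wsym Wdiag]; split. Qed.

Section MatrixWeight.
Context {R : realType} {V : finType} (W : V -> V -> R).
Hypothesis Whs : hollow_symmetric W.

Lemma matrix_weight_set2 u v : u != v -> matrix_weight W [set u; v] = W u v.
Proof.
have [Wsym Wdiag] := Whs => uv; rewrite /matrix_weight.
rewrite big_setU1 ?inE //= !big_set1 !big_setU1 ?inE //= !big_set1.
by rewrite !Wdiag (Wsym v); field.
Qed.

Lemma adj_matrix_weight : adj (complete_sgraph V) (matrix_weight W) =2 W.
Proof.
move=> u v; rewrite /adj inE cards2; have [->|uv] := eqVneq u v; first by rewrite Whs.2.
by rewrite matrix_weight_set2.
Qed.

Lemma matrix_edge_weighting : (forall u v, 0 <= W u v <= 1) ->
  edge_weighting (complete_sgraph V) (matrix_weight W).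
Proof.
move=> W01 e; rewrite inE => /cards2P [u [v [uv ->]]].
by rewrite matrix_weight_set2.
Qed.

Lemma total_weight_matrix :
  total_weight (complete_sgraph V) (matrix_weight W) =
  (\sum_u \sum_v W u v) / #|V|%:R ^+ 2.
Proof.
rewrite total_weight_qform; congr (_ / _); apply: eq_bigr => u _; rewrite mul1r.
by apply: eq_bigr => v _; rewrite mul1r adj_matrix_weight.
Qed.

End MatrixWeight.

Lemma wfree_blowup {R : realType} (F : set (wclique R)) (I V : finType)
    (W : I -> I -> R) (col : V -> I) : hollow_symmetric W ->
    wfree F (complete_sgraph I) (matrix_weight W) ->
  wfree F (complete_sgraph V) (matrix_weight (fun u v => W (col u) (col v))).
Proof.
move=> Whs W_free C FC /wcontainsP [phi contained]; apply: (W_free C FC).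
apply/wcontainsP; exists (col \o phi) => i j /contained.
by rewrite !adj_matrix_weight //; apply: hollow_symmetric_comp.
Qed.

Lemma exists_ge_average {R : realDomainType} (I : finType) (x f : I -> R) :
    (forall i, 0 <= x i) -> \sum_i x i = 1 ->
  exists i, \sum_j x j * f j <= f i.
Proof.
move=> x_ge0 x_sum1.
have [i0 _|I_empty] := pickP I; last first.
  by move: x_sum1; rewrite big_pred0 // => /eqP; rewrite eq_sym oner_eq0.
have [i _ i_max] := @arg_maxP _ R I i0 predT f isT; exists i.
rewrite -[leRHS]mul1r -x_sum1 mulr_suml.
by apply: ler_sum => j _; apply: ler_wpM2l => //; apply: i_max.
Qed.

Section BlowUp.
Context {R : realType} {I : finType}.
Variables (W : I -> I -> R) (x : I -> R) (l : R).
Hypothesis Whs : hollow_symmetric W.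
Hypothesis x_ge0 : forall i, 0 <= x i.
Hypothesis x_sum1 : \sum_i x i = 1.
Hypothesis wdeg_ge : forall j, l <= wdeg W x j.

(* Each new index is chosen to maximize its weight to the earlier ones; the
   maximum is at least the [x]-average. *)
Lemma greedy_sequence n : exists s : n.-tuple I,
  l * (n%:R * (n%:R - 1)) <= \sum_(i <- s) \sum_(j <- s) W i j.
Proof.
have [Wsym Wdiag] := Whs.
elim: n => [|n [s IH]]; first by exists [tuple]; rewrite big_nil mul0r mulr0.
have [i i_ge] := exists_ge_average (fun i => \sum_(j <- s) W i j) x_ge0 x_sum1.
exists [tuple of i :: s]; rewrite /= big_cons big_cons Wdiag add0r.
under [X in _ <= _ + X]eq_bigr => j _ do rewrite big_cons (Wsym j i).
rewrite big_split /=.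
suff new_ge : l * n%:R <= \sum_(j <- s) W i j by rewrite -natr1; move: IH new_ge; lra.
apply: le_trans i_ge; under eq_bigr do rewrite mulr_sumr.
rewrite exchange_big /= (_ : l * _ = \sum_(j <- s) l); last first.
  by rewrite big_const_seq count_predT size_tuple iter_addr_0 mulr_natr.
apply: ler_sum => j _; rewrite (eq_bigr (fun t => x t * W j t)) => [|t _].
  exact: wdeg_ge.
by rewrite Wsym.
Qed.

Lemma free_weights_blowup_ge (F : set (wclique R)) n :
    (forall i j, 0 <= W i j <= 1) ->
    wfree F (complete_sgraph I) (matrix_weight W) ->
  exists2 y, free_weights F n.+1 y & l * (1 - n.+1%:R^-1) <= y.
Proof.
move=> W01 W_free; have [s s_ge] := greedy_sequence n.+1.
pose Ws (u v : 'I_n.+1) := W (tnth s u) (tnth s v).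
have Ws_hs : hollow_symmetric Ws by apply: hollow_symmetric_comp.
exists (total_weight (complete_sgraph 'I_n.+1) (matrix_weight Ws)).
  exists (complete_sgraph _), (matrix_weight Ws); split => //.
    by apply: matrix_edge_weighting => // u v; apply: W01.
  exact: wfree_blowup.
have n_gt0 : 0 < n.+1%:R :> R by rewrite ltr0n.
rewrite total_weight_matrix // card_ord ler_pdivlMr ?exprn_gt0 //.
rewrite (_ : _ * n.+1%:R ^+ 2 = l * (n.+1%:R * (n.+1%:R - 1))).
  by move: s_ge; rewrite big_tuple; under eq_bigr do rewrite big_tuple.
by field; rewrite nat1r gt_eqF.
Qed.

End BlowUp.

(* The extremal clique: its heavy edges are the matching of the pairs [2i], [2i+1]. *)
Definition pair_weight {R : realFieldType} (a : R) {k : nat} (i j : 'I_k) : R :=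
  if i == j then 0 else if i./2 == j./2 then 1 else a.

Definition partner (i : nat) : nat := if odd i then i.-1 else i.+1.

Lemma partner_lt r j : (j < r)%N -> (partner j < r)%N = (j < r./2.*2)%N.
Proof. by rewrite /partner; case: ifP; lia. Qed.

Lemma partner_lt_double m j : (partner j < m.*2)%N = (j < m.*2)%N.
Proof. by rewrite /partner; case: ifP; lia. Qed.

Section ExtremalPattern.
Context {R : realFieldType}.
Implicit Types a : R.

Lemma pair_weight_hollow_symmetric a k : hollow_symmetric (@pair_weight R a k).
Proof.
split=> [i j|i]; last by rewrite /pair_weight eqxx.
by rewrite /pair_weight eq_sym (eq_sym i./2).
Qed.

Lemma pair_weight01 a k (i j : 'I_k) : 0 <= a <= 1 -> 0 <= pair_weight a i j <= 1.
Proof.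
by rewrite /pair_weight => a01; do 2?[case: ifP => _ //]; rewrite ?lexx ?ler01.
Qed.

Lemma pair_weightE a k (i j : 'I_k) :
  pair_weight a i j = a - a * (j == i)%:R + (1 - a) * (j == partner i :> nat)%:R.
Proof.
rewrite /pair_weight eq_sym; have [->|ji] := eqVneq j i.
  have /negbTE -> : i != partner i :> nat by rewrite /partner; case: ifP; lia.
  by rewrite mulr0 addr0 mulr1 subrr.
have -> : (i./2 == j./2) = (j == partner i :> nat).
  by rewrite /partner; case: ifP; move: ji; rewrite -val_eqE /=; lia.
by case: eqP => _; rewrite !(mulr0, mulr1, subr0, addr0) // addrC subrK.
Qed.

Lemma wdeg_pair_weight r a (x : nat -> R) (j : 'I_r) :
  wdeg (pair_weight a) (fun i => x i) j =
  a * (\sum_(i < r) x i) - a * x j +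
    (1 - a) * (if (j < r./2.*2)%N then x (partner j) else 0).
Proof.
rewrite -(sum_mul_delta (fun i : 'I_r => x i) j).
have -> : (if (j < r./2.*2)%N then x (partner j) else 0) =
    \sum_(i < r) x i * (i == partner j :> nat)%:R.
  rewrite -partner_lt //; case: ltnP => [partner_r|r_partner].
    by rewrite -(sum_mul_delta (fun i : 'I_r => x i) (Ordinal partner_r)).
  rewrite big1 // => i _; rewrite (ltn_eqF (leq_trans (ltn_ord i) r_partner)).
  by rewrite mulr0.
rewrite !mulr_sumr -sumrB -big_split /=; apply: eq_bigr => i _.
by rewrite pair_weightE; ring.
Qed.

(* The distribution proportional to the inverse defects equalizes the weighted
   degrees. *)
Definition extremal_dist r a (j : nat) : R :=
  (defect a (j < r./2.*2)%N)^-1 / inv_defect_sum r a.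

Section ExtremalDistribution.
Variables (r : nat) (a : R).
Hypothesis r_gt0 : (0 < r)%N.
Hypothesis a_gt : 1 / 2 < a.

Lemma extremal_dist_ge0 j : 0 <= extremal_dist r a j.
Proof. by rewrite divr_ge0 ?invr_ge0 ?ltW ?defect_gt0 ?inv_defect_sum_gt0. Qed.

Lemma sum_extremal_dist : \sum_(j < r) extremal_dist r a j = 1.
Proof.
rewrite -mulr_suml; pose D := [set j : 'I_r | j < r./2.*2]%N.
have card_D : #|D| = r./2.*2.
  rewrite -sum1_card (eq_bigl (fun j : 'I_r => j < r./2.*2)%N) => [|j]; last first.
    by rewrite inE.
  by rewrite -(big_ord_widen r (fun=> 1%N)) ?sum1_card ?card_ord //; lia.
have := sum_inv_defect a (subsetT D).
rewrite card_D cardsT card_ord (_ : r - _ = odd r)%N; last by lia.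
rewrite -/(inv_defect_sum r a) => sum_defects.
rewrite (_ : \sum_(j < r) _ = inv_defect_sum r a) ?divff ?gt_eqF ?inv_defect_sum_gt0 //.
by rewrite -sum_defects; apply: eq_big => [j|j _]; rewrite ?inE.
Qed.

Lemma wdeg_extremal_dist (j : 'I_r) :
  wdeg (pair_weight a) (fun i => extremal_dist r a i) j =
  a - (inv_defect_sum r a)^-1.
Proof.
rewrite wdeg_pair_weight sum_extremal_dist.
have defect_distE : defect a (j < r./2.*2)%N * extremal_dist r a j =
    (inv_defect_sum r a)^-1 by rewrite mulrA divff ?mul1r // gt_eqF ?defect_gt0.
rewrite -defect_distE /extremal_dist partner_lt_double /defect.
by case: ifP => _; ring.
Qed.

End ExtremalDistribution.

Lemma exists_optimal_dist r a : (0 < r)%N -> a <= 1 -> (r = 1%N -> 1 / 2 < a) ->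
  exists k (x : 'I_k -> R), [/\ (k <= r)%N, forall i, 0 <= x i, \sum_i x i = 1
    & forall j, density_value r a <= wdeg (pair_weight a) x j].
Proof.
move=> r_gt0 a_le1 r1; rewrite /density_value.
case: ifPn => [a_le|]; last rewrite -ltNge => a_gt.
  exists 2%N, (fun=> 1 / 2); split=> [|i||j]; [|by lra| |].
  - by case: r r_gt0 r1 => [|[|r]] // _ /(_ erefl); lra.
  - by rewrite sumr_const card_ord; lra.
  by rewrite (wdeg_pair_weight a (fun=> 1 / 2)) ltn_ord sumr_const card_ord; lra.
exists r, (fun j => extremal_dist r a j); split=> [//|i||j].
- exact: extremal_dist_ge0.
- exact: sum_extremal_dist.
by rewrite wdeg_extremal_dist.
Qed.

End ExtremalPattern.

Lemma pair_weight_free {R : realType} (r k : nat) (a : R) (ha : 0 <= a <= 1) :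
    (k <= r)%N ->
  wfree (forbidden r ha) (complete_sgraph 'I_k) (matrix_weight (pair_weight a)).
Proof.
have pair_hs : hollow_symmetric (@pair_weight R a k).
  exact: pair_weight_hollow_symmetric.
move=> kr C [] ->; last first.
  by move=> /wcontains_size_le; rewrite card_ord /= ltnNge kr.
move=> /wcontains_hP [u [v [t [uv ut vt]]]]; have /andP [a_ge0 _] := ha.
have gt_half (i j : 'I_k) : a < pair_weight a i j -> i./2 = j./2 /\ i != j.
  rewrite /pair_weight; case: eqP => [_|_]; first by rewrite ltNge a_ge0.
  by case: eqP => // _; rewrite ltxx.
move: vt uv ut; rewrite !adj_matrix_weight // => vt.
move=> /gt_half [uv_half uv] /gt_half [ut_half ut].
have : v != t by apply: contraTneq vt => ->; rewrite pair_hs.2 ltxx.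
by move: uv_half uv ut_half ut; rewrite -!val_eqE /=; lia.
Qed.

Lemma free_weights_forbidden_ge {R : realType} (r : nat) (a : R)
    (ha : 0 <= a <= 1) n : (0 < r)%N -> (r = 1%N -> 1 / 2 < a) ->
  exists2 y, free_weights (forbidden r ha) n.+1 y &
    density_value r a * (1 - n.+1%:R^-1) <= y.
Proof.
move=> r_gt0 r1; have /andP [_ a_le1] := ha.
have [k [x [kr x_ge0 x_sum1 wdeg_ge]]] := exists_optimal_dist r_gt0 a_le1 r1.
apply: (free_weights_blowup_ge _ x_ge0 x_sum1 wdeg_ge).
- exact: pair_weight_hollow_symmetric.
- by move=> i j; apply: pair_weight01.
exact: pair_weight_free.
Qed.

(* Rounding every weight up to the next threshold creates no forbidden clique, so
   only finitely many weightings compete for the maximum. *)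
Section MaximumWeight.
Context {R : realType} {I : finType}.
Variables (level : I -> R) (top : I).
Hypothesis level01 : forall i, 0 <= level i <= 1.
Hypothesis level_top : level top = 1.

Definition round_up (y : R) : I := [arg min_(i < top | y <= level i) level i]%O.

Lemma le_round_up y : y <= 1 -> y <= level (round_up y).
Proof. by move=> y_le1; rewrite /round_up; case: arg_minP; rewrite ?level_top. Qed.

Lemma lt_round_up y i : y <= 1 -> level i < level (round_up y) -> level i < y.
Proof.
move=> y_le1; rewrite /round_up; case: arg_minP => [|j _ j_min].
  by rewrite level_top.
by apply: contraTT; rewrite -!leNgt; apply: j_min.
Qed.

Variable F : set (wclique R).
Hypothesis F_level : forall C, F C -> forall e : {set 'I_(wc_size C)}, #|e| = 2%N ->
  exists i, wc_fun e = level i.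

Definition rounding {V : finType} (G : sgraph V) (w : {set V} -> R) :
    {ffun {set V} -> I} :=
  [ffun e => round_up (if e \in edges G then w e else 0)].

Lemma wfree_rounding (V : finType) (G : sgraph V) w :
    edge_weighting G w -> wfree F G w ->
  wfree F (complete_sgraph V) (level \o rounding G w).
Proof.
move=> w01 w_free C FC /wcontainsP [phi contained]; apply: (w_free C FC).
apply/wcontainsP; exists phi => i j ij; have := contained i j ij.
have [k wc_k] : exists k, wc_fun [set i; j] = level k.
  by apply: F_level; rewrite // cards2 neq_ltn ij.
rewrite [X in _ < X]/adj; case: ifP => _; last by rewrite ltNge wc_fun_pair_ge0.
rewrite /= ffunE wc_k; apply: lt_round_up.
by have /andP [] := adj01 (phi i) (phi j) w01.
Qed.

Lemma total_weight_le_rounding (V : finType) (G : sgraph V) w : edge_weighting G w ->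
  total_weight G w <= total_weight (complete_sgraph V) (level \o rounding G w).
Proof.
move=> w01; apply: ler_wpM2l; first by rewrite divr_ge0 ?exprn_ge0.
rewrite big_mkcond [leRHS]big_mkcond; apply: ler_sum => e _; rewrite inE.
have [eG|_] := boolP (e \in edges G).
  by rewrite (edges_card2 eG) /= ffunE eG le_round_up //; case/andP: (w01 e eG).
by case: ifP => // _; case/andP: (level01 (rounding G w e)).
Qed.

Lemma exists_is_beta n : (forall C, F C -> (1 < wc_size C)%N) ->
  exists b, is_beta F n b.
Proof.
move=> F_size; pose K := complete_sgraph 'I_n.
pose free_levels (c : {ffun {set 'I_n} -> I}) := `[< wfree F K (level \o c) >].
have zero01_weighting : edge_weighting K (fun=> 0 : R) by move=> e _; exact: zero01.
have free0 : free_levels (rounding K (fun=> 0)).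
  by apply/asboolP; apply: wfree_rounding => //; apply: wfree_zero.
have [c /asboolP c_free c_max] :=
  @arg_maxP _ R _ _ free_levels (fun c => total_weight K (level \o c)) free0.
exists (total_weight K (level \o c)); split.
  by exists K, (level \o c); split=> // e _; apply: level01.
move=> _ [G [w [w01 w_free ->]]]; apply: le_trans (total_weight_le_rounding w01) _.
by apply: c_max; apply/asboolP; apply: wfree_rounding.
Qed.

End MaximumWeight.

Lemma exists_is_beta_forbidden {R : realType} (r : nat) (a : R) (ha : 0 <= a <= 1) n :
  (0 < r)%N -> exists b, is_beta (forbidden r ha) n b.
Proof.
move=> r_gt0; pose level := tnth [tuple 0; a; 1].
apply: (@exists_is_beta _ _ level ord_max) => //.
- by move=> i; rewrite /level (tnth_nth 0); case: i => [[|[|[|i]]] Hi] //=;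
    rewrite ?lexx ?ler01.
- move=> C [] -> e _ /=; last by exists ord0.
  by rewrite /h_fun; case: ifP => _; [exists ord0|exists (@Ordinal 3 1 isT)].
by move=> C [] ->.
Qed.

Lemma is_density_squeeze {R : realType} (F : set (wclique R)) (l : R) :
    (forall n, exists b, is_beta F n b) ->
    (forall n y, free_weights F n.+1 y -> y <= l) ->
    (forall n, exists2 y, free_weights F n.+1 y & l * (1 - n.+1%:R^-1) <= y) ->
  is_density F l.
Proof.
move=> /choice [beta beta_max] upper lower; exists beta; split=> //.
rewrite -cvg_shiftS /=.
apply: (@squeeze_cvgr _ _ _ _ (fun n => l * (1 - n.+1%:R^-1)) (fun=> l)).
- apply: nearW => n; have [beta_free beta_ub] := beta_max n.+1.
  rewrite (upper n) // andbT; have [y y_free] := lower n.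
  by move/le_trans; apply; apply: beta_ub.
- suff : (l * (1 - n.+1%:R^-1) @[n --> \oo] --> l * (1 - 0))%classic.
    by rewrite subr0 mulr1.
  by apply: cvgM; [exact: cvg_cst|apply: cvgB; [exact: cvg_cst|exact: cvg_harmonic]].
- exact: cvg_cst.
Qed.

(* The hypothesis hr1 excludes exactly the case r = 1, a <= 1/2, where K_2^0 is
   forbidden, hence d(F) = 0 and not 1/2. *)
Theorem theorem3p6 (R : realType) (r : nat) (a : R) (hr : (0 < r)%N)
    (ha : 0 <= a <= 1) (hr1 : r = 1%N -> 1 / 2 < a) :
  is_density (forbidden r ha)
    (if a <= 1 / 2 then 1 / 2
     else if ~~ odd r then a + (1 - 2 * a) / r%:R
     else a ^+ 2 * (r%:R - 1) / (a * (r%:R + 1) - 1)).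
Proof.
rewrite -density_valueE //; apply: is_density_squeeze => n.
- exact: exists_is_beta_forbidden.
- by move=> _ [G [w [w01 w_free ->]]]; apply: total_weight_le w_free; rewrite ?card_ord.
- exact: free_weights_forbidden_ge.
Qed.
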